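(* Let $p$ be a prime and let $G(p;S)$ be a strongly regular circulant graph with symbol $S\subseteq\{1,\ldots,p-1\}$. Let $n$ be a composite number divisible by $p$. Then the adjacency spectrum of the circulant graph $G\big(n;\bigcup_{i=0}^{n/p-1}(ip+S)\big)$ contains exactly four distinct eigenvalues, where $ip+S=\{ip+s\mid s\in S\}$.
   Context: For a positive integer $N$ and $S\subseteq\{1,\ldots,N-1\}$ with $S=N-S:=\{N-s\mid s\in S\}$, the circulant graph $G(N;S)$ has vertex set $\mathbb{Z}_N$, with $i\sim j$ iff $i-j\equiv s\pmod N$ for some $s\in S$. A strongly regular graph is a connected regular graph whose adjacency matrix has exactly three distinct eigenvalues. *)

(* Defs.v *)
From mathcomp Require Import all_boot all_order all_algebra.
From mathcomp Require Import finmap zify.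

Set Implicit Arguments.
Unset Strict Implicit.
Unset Printing Implicit Defensive.

Import GRing.Theory.

Local Open Scope fset_scope.
Local Open Scope nat_scope.

Definition composite (n : nat) : bool := (1 < n) && ~~ prime n.

Definition is_symbol (N : nat) (S : {fset nat}) : Prop :=
  (forall s, s \in S -> 1 <= s <= N.-1) /\ S = [fset (N - s)%N | s in S].

(* The vertex set Z_N is represented by the residues 0, ..., N-1 ('I_N), and
   the difference i - j is taken in int, so that it is not truncated. *)
Definition circulant (N : nat) (S : {fset nat}) : rel 'I_N :=
  fun i j => [exists s : S, (i%:Z - j%:Z == (val s)%:Z %[mod N%:Z])%Z].
Arguments circulant : clear implicits.

Definition lift_symbol (p n : nat) (S : {fset nat}) : {fset nat} :=
  \bigcup_(i <- iota 0 (n %/ p)) [fset (i * p + s)%N | s in S].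

(* Spectra are taken over an arbitrary algebraically closed number field C
   (e.g. algC, or R[i] for the real numbers R). *)
Definition adjacency_mx (C : numClosedFieldType) (N : nat) (e : rel 'I_N) :
  'M[C]_N := (\matrix_(i, j) (e i j)%:R)%R.

Definition has_distinct_eigenvalues (C : numClosedFieldType) (N : nat)
    (A : 'M[C]_N) (m : nat) : Prop :=
  exists2 E : {fset C}, #|` E| = m & forall a, (a \in E) = eigenvalue A a.

Definition connected_graph (N : nat) (e : rel 'I_N) : Prop :=
  forall i j, connect e i j.

Definition regular_graph (N : nat) (e : rel 'I_N) : Prop :=
  exists k, forall i, #|[set j | e i j]| = k.

Definition strongly_regular (C : numClosedFieldType) (N : nat) (e : rel 'I_N) :
  Prop :=
  [/\ connected_graph e, regular_graph e
    & has_distinct_eigenvalues (adjacency_mx C e) 3].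

Lemma circulant_sym N S : is_symbol N S -> symmetric (circulant N S).
Proof.
move=> [S1 SE].
suff H i j : circulant N S i j -> circulant N S j i.
  by move=> i j; apply/idP/idP; apply: H.
case/existsP=> s /eqP Hs; apply/existsP.
have /andP[s0 sN] := S1 _ (valP s).
have SN x : x \in S -> N - x \in S.
  by move=> xS; rewrite SE; apply/imfsetP; exists x.
have tS := SN _ (valP s).
exists [` tS]; apply/eqP => /=.
have -> : (j%:Z - i%:Z = - (i%:Z - j%:Z))%R by rewrite opprB.
have -> : ((N - val s)%N%:Z = - (val s)%:Z + N%:Z)%R by lia.
by rewrite modzDr -[LHS]modzNm Hs modzNm.
Qed.

Lemma circulant_irrefl N S : is_symbol N S -> irreflexive (circulant N S).
Proof.
move=> [S1 _] i; apply/existsP => -[s].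
have := S1 _ (valP s); rewrite subrr mod0z; move: (val s) => x /andP[x0 xN].
by rewrite modz_small; lia.
Qed.

Lemma lift_symbolP p n S : 0 < n -> p %| n -> is_symbol p S ->
  is_symbol n (lift_symbol p n S).
Proof.
move=> n0 /dvdnP[m nE] [S1 SE].
have p0 : 0 < p by case: p nE {S1 SE} => //; lia.
have mE : n %/ p = m by rewrite nE mulnK.
have liftP x : reflect (exists2 i, i < m & exists2 s, s \in S & x = i * p + s)
    (x \in lift_symbol p n S).
  apply: (iffP (bigfcupP _ _ _ _)) => [[i]|[i im [s sS ->]]].
    rewrite mE mem_iota andbT => im /imfsetP[s sS ->]; exists i; first lia.
    by exists s.
  exists i; first by rewrite mE mem_iota andbT; lia.
  by apply/imfsetP; exists s.
have sub x : x \in lift_symbol p n S ->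
    (1 <= x <= n.-1) /\ (n - x \in lift_symbol p n S).
  case/liftP=> i im [s sS ->]; have := S1 _ sS; split; first nia.
  apply/liftP; exists (m - i.+1); first lia.
  exists (p - s); last nia.
  by rewrite SE; apply/imfsetP; exists s.
split=> [x /sub[]//|]; apply/fsetP => x; apply/idP/imfsetP => [xS|[y yS ->]].
  have [? ?] := sub _ xS; exists (n - x) => //; lia.
by have [] := sub _ yS.
Qed.

(* Main.v *)
(* Put m = n / p. Reduction mod p identifies the lifted graph's adjacency
   matrix with Q A Q^T, where A is the adjacency matrix of G(p;S) and Q is the
   n x p incidence matrix of residues, with Q^T Q = m. Its eigenvalues are
   therefore 0 (as p < n) and the m * l for l an eigenvalue of A. It remains to
   see that 0 is not an eigenvalue of A: over F_p, A is a sum of #|S| powers of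
   the cyclic shift P, and P^p = 1, so A^p = #|S| by Frobenius, and
   0 < #|S| < p. Hence p does not divide det A. *)
Require Import Defs.
From mathcomp Require Import all_boot all_order all_algebra.
From mathcomp Require Import finmap zify.

Set Implicit Arguments.
Unset Strict Implicit.
Unset Printing Implicit Defensive.

Import GRing.Theory Num.Theory.

Local Open Scope fset_scope.

(** Since [j < N], the subtraction [N - j] is not truncated, and the integer difference becomes a
    residue in [nat]. The bound on [S] makes each symbol element its own residue. *)
Lemma circulantE N (S : {fset nat}) (i j : 'I_N) :
  (forall s, s \in S -> s < N) ->
  circulant N S i j = ((i + (N - j)) %% N \in S).
Proof.
move=> SN; have jN := ltn_ord j; have N0 : 0 < N by lia.
have dE : ((i%:Z - j%:Z)%R %% N%:Z)%Z = Posz ((i + (N - j)) %% N).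
  rewrite -modz_nat -(modzDr (i%:Z - j%:Z)%R).
  by congr ((_ %% _)%Z); lia.
apply/existsP/idP => [[s]|dS].
  rewrite dE modz_nat (modn_small (SN _ (valP s))).
  by rewrite eqz_nat => /eqP ->; apply: valP.
by exists [` dS]; rewrite dE /= modz_nat modn_mod.
Qed.

Lemma mem_lift_symbol p n (S : {fset nat}) x :
  p %| n -> (forall s, s \in S -> s < p) ->
  (x \in lift_symbol p n S) = (x < n) && (x %% p \in S).
Proof.
move=> pn Sp; apply/bigfcupP/andP => [[i]|[xn xS]].
  rewrite mem_iota andbT add0n => im /imfsetP[s sS ->] /=.
  have sp := Sp _ sS; rewrite modnMDl modn_small //; split => //.
  by move: im; rewrite leq_divRL //; nia.
have p0 : 0 < p by have := Sp _ xS; lia.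
exists (x %/ p); last by apply/imfsetP; exists (x %% p); rewrite //= -divn_eq.
by rewrite mem_iota andbT add0n ltn_divLR // divnK.
Qed.

(** Each block of [p] consecutive integers meets the class of [r] once; the induction splits off the
    last block. *)
Lemma sum_modn_eq p m r : r < p ->
  \sum_(0 <= i < m * p) (i %% p == r : nat) = m.
Proof.
move=> rp; elim: m => [|m IHm]; first by rewrite mul0n big_geq.
rewrite mulSn addnC (@big_cat_nat _ _ _ (m * p)) ?leq_addr //= IHm.
rewrite -{1}[m * p]add0n big_addn addKn big_mkord -[RHS]addn1; congr addn.
rewrite (bigD1 (Ordinal rp)) //= [(r + _)%N]addnC modnMDl modn_small // eqxx.
rewrite big1 // => i ir.
by rewrite addnC modnMDl modn_small //; move: ir; rewrite -val_eqE /= => /negPf ->.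
Qed.

Local Open Scope ring_scope.

Section ShiftMatrix.

Variables (R : nzRingType) (q : nat).

(** The cyclic shift [P]. The size [q.+2] gives the indices their ring structure, so [i - j] is
    subtraction modulo [q.+2]. *)
Definition shift_mx : 'M[R]_q.+2 :=
  \matrix_(i, j) (i - j == 1)%:R.

Lemma shift_mxX k : shift_mx ^+ k = \matrix_(i, j) (i - j == k%:R)%:R.
Proof.
elim: k => [|k IHk]; apply/matrixP => i j.
  by rewrite expr0 !mxE subr_eq0.
rewrite exprS IHk !mxE (bigD1 (i - 1)) //= !mxE big1 => [|l li].
  rewrite addr0 subKr eqxx mul1r -natr1.
  by rewrite -subr_eq addrAC.
rewrite !mxE; case: eqP => [il|_]; last by rewrite mul0r.
by case/eqP: li; rewrite -il subKr.
Qed.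

Lemma shift_mx_order : shift_mx ^+ q.+2 = 1.
Proof.
rewrite shift_mxX; apply/matrixP => i j; rewrite !mxE.
have -> : q.+2%:R = 0 :> 'I_q.+2 by apply: (@pchar_Zp q.+2).
by rewrite subr_eq0.
Qed.

(** The elements of [S] are distinct residues, so at most one power of the shift contributes to a
    given entry. *)
Lemma circulant_shift_mx (S : {fset nat}) :
  (forall s, s \in S -> (s < q.+2)%N) ->
  \matrix_(i, j) (circulant q.+2 S i j)%:R = \sum_(s <- S) shift_mx ^+ s.
Proof.
move=> SN; apply/matrixP => i j; rewrite summxE !mxE circulantE //.
have dE s : s \in S -> (i - j == s%:R) = (s == (i + (q.+2 - j)) %% q.+2)%N.
  move=> sS; rewrite -val_eqE /= Zp_nat /= modnDmr eq_sym.
  by rewrite (modn_small (SN _ sS)).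
set d := (_ %% _)%N in dE *.
under eq_big_seq => s sS do rewrite shift_mxX mxE dE //.
case: (boolP (d \in S)) => dS.
  rewrite (big_fsetD1 d) //= eqxx big_seq big1 ?addr0 // => s.
  by rewrite in_fsetD1 => /andP[/negPf ->].
rewrite big_seq big1 // => s sS; case: eqP => // sd.
by rewrite -sd sS in dS.
Qed.

End ShiftMatrix.

Lemma expr_sum_pchar (R : comNzRingType) p (I : Type) (r : seq I) (F : I -> R) :
  p \in [pchar R] -> (\sum_(i <- r) F i) ^+ p = \sum_(i <- r) F i ^+ p.
Proof.
move=> pR; rewrite -(pFrobenius_autE pR) rmorph_sum /=.
by apply: eq_bigr => i _; rewrite pFrobenius_autE.
Qed.

Lemma circulant_mx_exp_prime (R : comNzRingType) q (S : {fset nat}) :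
  q.+2 \in [pchar R] -> (forall s, s \in S -> (s < q.+2)%N) ->
  (\matrix_(i, j) (circulant q.+2 S i j)%:R : 'M[R]_q.+2) ^+ q.+2
    = (#|` S|)%:R%:M.
Proof.
move=> chR SN; rewrite circulant_shift_mx //.
(* Frobenius needs a commutative ring, which matrices do not form. It is applied to the polynomial
   with exponents in [S], then carried over by evaluation at the shift. *)
have chP : q.+2 \in [pchar {poly R}] by rewrite pchar_poly.
have -> : \sum_(s <- S) shift_mx R q ^+ s
    = horner_mx (shift_mx R q) (\sum_(s <- S) 'X^s).
  by rewrite rmorph_sum; apply: eq_bigr => s _; rewrite rmorphXn /= horner_mx_X.
rewrite -rmorphXn expr_sum_pchar // rmorph_sum /=.
under eq_bigr => s _ do
  rewrite !rmorphXn /= horner_mx_X exprAC shift_mx_order expr1n.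
by rewrite big_const_seq count_predT iter_addr_0 raddfMn.
Qed.

Lemma symbol_card p S : (0 < p)%N -> is_symbol p S -> (#|` S| < p)%N.
Proof.
move=> p0 [S1 _].
suff: (#|` S| <= size (iota 1 p.-1))%N by rewrite size_iota; lia.
apply: uniq_leq_size; first exact: fset_uniq.
by move=> s /S1; rewrite mem_iota; lia.
Qed.

Lemma circulant_mx_unit (C : numClosedFieldType) p S :
  prime p -> is_symbol p S -> S != fset0 ->
  adjacency_mx C (circulant p S) \in unitmx.
Proof.
case: p => [|[|q]] // p_prime symS S0.
(* An integer matrix has a determinant that can be both reduced mod [p] and mapped into [C]. *)
set A : 'M[int]_q.+2 := \matrix_(i, j) (circulant q.+2 S i j)%:R.
have mapA (R : nzRingType) :
    map_mx intr A = \matrix_(i, j) (circulant q.+2 S i j)%:R :> 'M[R]_q.+2.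
  by apply/matrixP => i j; rewrite !mxE; case: circulant.
have ltS s : s \in S -> (s < q.+2)%N by case: symS => S1 _ /S1; lia.
have chF := pchar_Fp p_prime.
have detF : (\det A)%:~R != 0 :> 'F_q.+2.
  (* Over ['F_q.+2], invertibility is tested on the power [q.+2], a scalar matrix. *)
  rewrite -det_map_mx -unitfE -unitmxE mapA -(unitrX_pos _ (ltn0Sn q.+1)).
  rewrite circulant_mx_exp_prime // unitmxE det_scalar unitfE expf_neq0 //.
  rewrite -(dvdn_pcharf chF) gtnNdvd ?cardfs_gt0 //.
  exact: symbol_card.
rewrite /adjacency_mx -mapA unitmxE det_map_mx unitfE intr_eq0.
by apply: contraNneq detF => ->.
Qed.

Section ResidueMatrix.

Variables (R : comNzRingType) (n p : nat).

Definition residue_mx : 'M[R]_(n, p) := \matrix_(i, r) (i %% p == r)%N%:R.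

(** Row [i] of [residue_mx] has a single 1, in column [i %% p], so the double sum collapses to one
    entry of the small matrix. *)
Lemma lift_circulant_mx (S : {fset nat}) : (0 < p)%N ->
  (p %| n)%N -> (forall s, s \in S -> (s < p)%N) ->
  \matrix_(i, j) (circulant n (lift_symbol p n S) i j)%:R
    = residue_mx *m (\matrix_(i, j) (circulant p S i j)%:R) *m residue_mx^T.
Proof.
move=> p0 pn Sp; apply/matrixP => i j.
pose rho (k : 'I_n) : 'I_p := Ordinal (ltn_pmod k p0).
have QE k r : residue_mx k r = (r == rho k)%:R by rewrite mxE eq_sym.
rewrite !mxE (bigD1 (rho j)) //= big1 => [|r rj]; last first.
  by rewrite [_^T _ _]mxE QE (negPf rj) mulr0.
rewrite [_^T _ _]mxE QE eqxx mulr1 addr0 mxE (bigD1 (rho i)) //= big1 => [|r ri].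
  rewrite QE eqxx mul1r addr0 mxE; congr (_%:R).
  rewrite !circulantE //; last by move=> s; rewrite mem_lift_symbol // => /andP[].
  rewrite mem_lift_symbol // ltn_pmod; last by case: (n) i => // -[].
  rewrite modn_dvdm //=; congr ((_ : nat) \in S).
  rewrite modnDml; apply/eqP; rewrite eqn_modDl.
  (* Adding [j] to both sides reduces the congruence of [n - j] and [p - j %% p] to that of [n] and
     [p], both 0 mod [p]. *)
  have jn := ltn_ord j; rewrite -(eqn_modDr j) subnK ?(ltnW jn) //.
  rewrite -modnDmr subnK; last by rewrite ltnW ?ltn_pmod.
  by rewrite modnn (eqP pn).
by rewrite QE (negPf ri) mul0r.
Qed.

Lemma tr_residue_mx_mul : (p %| n)%N ->
  residue_mx^T *m residue_mx = (n %/ p)%:R%:M.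
Proof.
move=> pn; apply/matrixP => r s; rewrite !mxE.
under eq_bigr => i _ do rewrite !mxE -natrM.
rewrite -natr_sum -[RHS]mulr_natr -natrM; congr (_%:R).
case: (eqVneq r s) => [<-|rs]; last first.
  rewrite muln0 big1 // => i _; case: eqP => // -> /=.
  by rewrite mul1n; apply/eqP; rewrite eqb0.
rewrite muln1 -[RHS](sum_modn_eq (n %/ p) (ltn_ord r)) divnK // big_mkord.
by apply: eq_bigr => i _; case: eqP.
Qed.

End ResidueMatrix.

(** The product has rank at most [p < n], so 0 is an eigenvalue. For [a != 0], multiplication by [Q]
    and by [Q^T] carries row eigenvectors down and back up. *)
Lemma eigenvalue_lift (F : fieldType) n p (Q : 'M[F]_(n, p)) (A : 'M[F]_p) c a :
  (p < n)%N -> c != 0 -> Q^T *m Q = c%:M ->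
  eigenvalue (Q *m A *m Q^T) a = (a == 0) || eigenvalue A (a / c).
Proof.
move=> pn c0 QQ; case: (eqVneq a 0) => [->|a0] /=.
  rewrite /eigenvalue /eigenspace raddf0 subr0 -mxrank_eq0 mxrank_ker subn_eq0.
  rewrite -ltnNge (leq_ltn_trans _ pn) // (leq_trans (mxrankM_maxr _ _)) //.
  exact: rank_leq_row.
apply/eigenvalueP/eigenvalueP => [[v vB v0]|[w wA w0]].
  exists (v *m Q).
    have vQA : c *: (v *m Q *m A) = a *: (v *m Q).
      by rewrite [RHS]scalemxAl -vB -mul_mx_scalar -QQ !mulmxA.
    by rewrite mulrC -scalerA -vQA scalerA mulVf // scale1r.
  (* If [v *m Q = 0], the eigenvector equation gives [a *: v = 0]. *)
  apply: contra_neq v0 => vQ0; apply/eqP.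
  by move: vB; rewrite !mulmxA vQ0 !mul0mx => /esym/eqP; rewrite scaler_eq0 (negPf a0).
exists (w *m Q^T).
  rewrite !mulmxA -(mulmxA w) QQ mul_mx_scalar -!scalemxAl wA.
  by rewrite -scalemxAl scalerA mulrC divfK.
apply: contra_neq w0 => wQ0; apply/eqP.
have: w *m Q^T *m Q = 0 by rewrite wQ0 mul0mx.
by rewrite -mulmxA QQ mul_mx_scalar => /eqP; rewrite scaler_eq0 (negPf c0).
Qed.

(** An empty symbol gives the zero matrix, whose only possible eigenvalue is 0, not three values. *)
Lemma srg_symbol_neq0 (C : numClosedFieldType) p S :
  strongly_regular C (circulant p S) -> S != fset0.
Proof.
case=> _ _ [E cardE memE]; apply/eqP => S0.
have A0 : adjacency_mx C (circulant p S) = 0.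
  apply/matrixP => i j; rewrite !mxE; case: (boolP (circulant _ _ _ _)) => // /existsP[s _].
  by move: (val s) (valP s) => x; rewrite S0.
suff /fsubset_leq_card : E `<=` [fset 0] by rewrite cardE cardfs1.
apply/fsubsetP => a; rewrite memE A0 in_fset1 => /eigenvalueP[v].
by rewrite mulmx0 => /esym/eqP; rewrite scaler_eq0 => /orP[//|->].
Qed.

Local Close Scope ring_scope.

Theorem theorem4p4 (C : numClosedFieldType) (p : nat) (S : {fset nat}) (n : nat)
  (p_prime : prime p) (S_symbol : is_symbol p S)
  (S_srg : strongly_regular C (circulant p S))
  (n_composite : composite n) (p_dvd_n : p %| n) :
  has_distinct_eigenvalues
    (adjacency_mx C (circulant n (lift_symbol p n S))) 4.
Proof.
have S0 := srg_symbol_neq0 S_srg.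
have [_ _ [E cardE memE]] := S_srg.
have /andP[n1 n_np] := n_composite.
have p0 := prime_gt0 p_prime.
have p_lt_n : p < n.
  rewrite ltn_neqAle dvdn_leq ?(ltnW n1) // andbT.
  by apply: contraNneq n_np => <-.
have ltS s : s \in S -> s < p by case: S_symbol => S1 _ /S1; lia.
set m : C := (n %/ p)%:R%R.
have m0 : m != 0%R by rewrite pnatr_eq0 -lt0n divn_gt0 // ltnW.
have E0 : 0%R \notin E.
  rewrite memE; apply/negP => /eigenvalueP[v vA v0].
  have unitA := circulant_mx_unit C p_prime S_symbol S0.
  by move: v0; rewrite -(mulmxK unitA v) vA scale0r mul0mx eqxx.
(* Multiplication by [m] is injective, giving three values, and 0 is a fourth since it is not in
   [E]. *)
exists (0%R |` [fset (m * l)%R | l in E]) => [|a].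
  rewrite cardfsU1 card_imfset /=; last exact: mulfI.
  rewrite cardE; case: imfsetP => // -[l lE /esym/eqP].
  by rewrite mulf_eq0 (negPf m0) => /eqP l0; rewrite -l0 lE in E0.
rewrite /adjacency_mx lift_circulant_mx //.
rewrite (eigenvalue_lift _ _ p_lt_n m0 (tr_residue_mx_mul C p_dvd_n)).
rewrite in_fset1U -memE; congr (_ || _); apply/imfsetP/idP => [[l lE ->]|aE].
  by rewrite mulrC mulKf.
by exists (a / m)%R; rewrite //= mulrC divfK.
Qed.
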